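(* Let $n\ge 3$ and let $a,b\in\mathbb{Z}_n$ be nonzero with $a\neq b$. Then \[p_{n}(\{0,a,b\}) = \begin{cases} 3 &\text{if there are integers } j\ge 0,\ m_a,\ m_b \text{ with } n \equiv 0 \bmod 3^{j+1},\ a = 3^j m_a,\ b = 3^j m_b,\\ & \quad m_a,m_b \not\equiv 0 \bmod 3,\ \text{and } m_a + m_b \equiv 0 \bmod 3,\\ 1 &\text{if } n \equiv 0 \bmod 7,\ |\langle a \rangle| = 7,\ \text{and } b=3a \text{ or } b=5a \text{ in } \mathbb{Z}_n,\\ 2 &\text{otherwise}. \end{cases}\]
   Context: $\mathbb{Z}_n$ is the additive group of integers modulo $n$; its elements are identified with the integers $0,1,\dots,n-1$ in the equalities $a=3^jm_a$, $b=3^jm_b$. $\langle a\rangle$ is the subgroup of $\mathbb{Z}_n$ generated by $a$. For $S\subseteq \mathbb{Z}_n$ and $x\in\mathbb{Z}_n$, the set $x+S=\{x+s : s\in S\}$ is a translate of $S$. A coloring of the elements of $\mathbb{Z}_n$ with $k$ colors is $S$-polychromatic if every translate of $S$ contains an element of each of the $k$ colors. The polychromatic number $p_n(S)$ is the largest $k$ such that there is an $S$-polychromatic coloring of $\mathbb{Z}_n$ with $k$ colors. *)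

(* Defs.v *)
From HB Require Import structures.
From mathcomp Require Import all_boot all_order all_algebra all_fingroup.

Set Implicit Arguments.
Unset Strict Implicit.
Unset Printing Implicit Defensive.

Import GRing.Theory.
Local Open Scope ring_scope.

(* 'Z_n is the ring of integers modulo n only for 1 < n. *)

Definition translate (n : nat) (x : 'Z_n) (S : {set 'Z_n}) : {set 'Z_n} :=
  [set x + s | s in S].

Definition polychromatic (n k : nat) (S : {set 'Z_n})
    (f : {ffun 'Z_n -> 'I_k}) : bool :=
  [forall x : 'Z_n, forall c : 'I_k, [exists y in translate x S, f y == c]].

Definition polychromatic_colorable (n : nat) (S : {set 'Z_n}) (k : nat) : bool :=
  [exists f : {ffun 'Z_n -> 'I_k}, polychromatic S f].

(* Only k <= #|S| needs to be considered: a translate of S has at most #|S|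
   colors. See polychromatic_colorable_leq and polychromatic_numberP. *)
Definition polychromatic_number (n : nat) (S : {set 'Z_n}) : nat :=
  \max_(k < #|S|.+1 | polychromatic_colorable S k) k.

Lemma polychromatic_colorable_leq (n : nat) (S : {set 'Z_n}) (k : nat) :
  polychromatic_colorable S k -> (k <= #|S|)%N.
Proof.
case/existsP=> f /forallP/(_ 0)/forallP colf.
have sub: [set: 'I_k] \subset [set f y | y in translate 0 S].
  apply/subsetP=> c _; have /existsP[y /andP[yS /eqP <-]] := colf c.
  exact: imset_f.
rewrite -[k in (k <= _)%N]card_ord -cardsT (leq_trans (subset_leq_card sub)) //.
by rewrite (leq_trans (leq_imset_card _ _)) // leq_imset_card.
Qed.

Lemma polychromatic_colorable1 (n : nat) (S : {set 'Z_n}) :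
  S != set0 -> polychromatic_colorable S 1.
Proof.
case/set0Pn=> s sS; apply/existsP; exists [ffun=> ord0].
apply/forallP=> x; apply/forallP=> c; apply/existsP; exists (x + s).
by rewrite imset_f //= ffunE [c]ord1.
Qed.

Lemma polychromatic_numberP (n : nat) (S : {set 'Z_n}) : S != set0 ->
  polychromatic_colorable S (polychromatic_number S) /\
  (forall k, polychromatic_colorable S k -> (k <= polychromatic_number S)%N).
Proof.
move=> S0; split=> [|k colk].
  have S1: (1 < #|S|.+1)%N by rewrite ltnS card_gt0.
  rewrite /polychromatic_number (bigop.bigmax_eq_arg (Ordinal S1)).
    by case: arg_maxnP => //; exact: polychromatic_colorable1.
  exact: polychromatic_colorable1.
have ltk: (k < #|S|.+1)%N by rewrite ltnS polychromatic_colorable_leq.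
exact: (@leq_bigmax_cond _ _ (@nat_of_ord _) (Ordinal ltk)).
Qed.

(* Residues a, b : 'Z_n are read as integers in [0, n) through nat_of_ord. *)
Definition three_color_case (n : nat) (a b : 'Z_n) : Prop :=
  exists (j : nat) (ma mb : int),
    [/\ (3 ^ j.+1 %| n)%N,
        (a : nat)%:Z = 3 ^+ j * ma /\ (b : nat)%:Z = 3 ^+ j * mb,
        ~~ (3 %| ma)%Z /\ ~~ (3 %| mb)%Z
      & (3 %| ma + mb)%Z].

Definition one_color_case (n : nat) (a b : 'Z_n) : Prop :=
  [/\ (7 %| n)%N, #|<[a]>%g| = 7%N & b = a *+ 3 \/ b = a *+ 5].

(* Main.v *)
Require Import Defs.
From HB Require Import structures.
From mathcomp Require Import all_boot all_order all_algebra all_fingroup.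
From mathcomp Require Import cyclic zify.
Import GRing.Theory.
Local Open Scope ring_scope.

(** Three colors. If every translate of {0, a, b} meets three colors under [f],
then the color of x + a + b avoids those of x + a and x + b, so it is the color
of x; thus a + b is a period of [f], and in the same way so is 3a. The periods
form a subgroup that misses a, so a is not divisible by
g = gcd (3a, a + b, n), while 3a is. Only the prime 3 can account for this: if
3^j is the exact power of 3 in a, then 3^(j+1) divides g, hence n and a + b.
Conversely, under these divisibilities, x |-> floor (x / 3^j) mod 3 is well
defined on Z_n, and adding a or b adds to it two distinct nonzero residues
modulo 3.

Two colors. Place Z_n on a circle of length n, and color x according to the
half-open half circle that contains kx. A translate of {0, a, b} then appears as
a rotated copy of {0, ka, kb}, and a half circle contains no such copy as soon
as the three gaps between 0, ka and kb have length at most n/2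
([two_colorable_spread]). It remains to find the multiplier k.
- If a or b has even order, a multiple of it is antipodal to 0, and the third
  point may be anywhere.
- If a has odd order m and b is outside the subgroup generated by a, put ka just
  below n/2. The multiplier may still be changed by multiples of m, which moves
  kb through a coset of step at most n/3, so kb can be placed on the arc
  opposite to the one from 0 to ka.
- If b = qa, everything happens in Z_m. For q even, k = (m - 1)/2 works. For q
  odd, the reflection x |-> a - x exchanges q and m + 1 - q, so assume
  2q <= m + 1; then k = (m + N)/2 works for every odd N with
  m <= N(q - 1) and Nq <= 2m. Such an N exists unless m = 7 and q = 3.

One color. For m = 7 and q = 3 or 5 the translates are the lines of the Fano
plane, which has no 2-coloring without monochromatic lines. *)

(** * Colorings of the translates of a triple *)

Lemma polychromatic_tripleP (n k : nat) (a b : 'Z_n) :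
  reflect (exists f : 'Z_n -> 'I_k,
             forall x c, c \in [:: f x; f (x + a); f (x + b)])
          (polychromatic_colorable [set 0; a; b] k).
Proof.
apply: (iffP existsP) => [[f /forallP fP] | [f fP]].
  exists f => x c; have /forallP/(_ c)/existsP[y /andP[]] := fP x.
  case/imsetP=> s; rewrite !inE => sS -> /eqP <-.
  by case/orP: sS => [/orP[]|] /eqP ->; rewrite ?addr0 eqxx ?orbT.
exists (finfun f); apply/forallP=> x; apply/forallP=> c.
have cover s : s \in [set 0; a; b] -> c = f (x + s) ->
    [exists y in translate x [set 0; a; b], finfun f y == c].
  move=> sS ->; apply/existsP; exists (x + s).
  by rewrite imset_f //= ffunE.
have := fP x c; rewrite !inE => /or3P[] /eqP Dc.
- by apply: (cover 0); rewrite ?addr0 // !inE eqxx.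
- by apply: (cover a); rewrite // !inE eqxx orbT.
- by apply: (cover b); rewrite // !inE eqxx orbT.
Qed.

(** The surplus colors are merged into the last of the remaining ones. *)
Lemma polychromatic_colorableW (n : nat) (S : {set 'Z_n}) (j k : nat) :
  (0 < j <= k)%N -> polychromatic_colorable S k -> polychromatic_colorable S j.
Proof.
case: j => // j /andP[_ ltjk] /existsP[f /forallP fP].
apply/existsP; exists [ffun x => inord (minn (f x) j) : 'I_j.+1].
apply/forallP=> x; apply/forallP=> c.
have ltck : (c < k)%N by apply: leq_trans ltjk.
have /forallP/(_ (Ordinal ltck))/existsP[y /andP[yS /eqP Dfy]] := fP x.
apply/existsP; exists y; rewrite yS ffunE Dfy /=; apply/eqP/val_inj => /=.
have ltcj := ltn_ord c; rewrite inordK; lia.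
Qed.

(** By merging colors, failure for one number of colors excludes all larger
numbers. *)
Lemma polychromatic_number_eq (n : nat) (S : {set 'Z_n}) (k : nat) :
    (0 < k)%N -> polychromatic_colorable S k ->
  ~~ polychromatic_colorable S k.+1 -> polychromatic_number S = k.
Proof.
move=> k0 colk ncolk; have S0 : S != set0.
  by rewrite -card_gt0 (leq_trans k0) // polychromatic_colorable_leq.
have [colp maxp] := polychromatic_numberP S0.
apply/eqP; rewrite eqn_leq maxp // andbT leqNgt; apply: contra ncolk => ltkp.
by apply: polychromatic_colorableW colp; rewrite ltkp.
Qed.

Definition two_colorable {n : nat} (a b : 'Z_n) : Prop :=
  exists f : 'Z_n -> bool,
    forall x, ~~ ((f (x + a) == f x) && (f (x + b) == f x)).

Lemma two_colorableP (n : nat) (a b : 'Z_n) :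
  polychromatic_colorable [set 0; a; b] 2 <-> two_colorable a b.
Proof.
split=> [/polychromatic_tripleP[f fP] | [f fP]].
  exists (fun x => f x == 0) => x; have := fP x 0; have := fP x 1.
  rewrite !inE; move: (f x) (f (x + a)) (f (x + b)).
  by do 3![case=> [[|[|//]] ?]].
apply/polychromatic_tripleP; exists (fun x => if f x then 1 else 0) => x c.
move: (fP x); rewrite !inE.
by case: (f x) (f (x + a)) (f (x + b)) c => [] [] [] [[|[|//]] ?].
Qed.

Lemma two_colorable_sym (n : nat) (a b : 'Z_n) :
  two_colorable a b -> two_colorable b a.
Proof. by case=> f fP; exists f => x; rewrite andbC. Qed.

(** The map x |-> a - x sends {0, a, b} to {0, a, a - b}. *)
Lemma two_colorable_reflect (n : nat) (a b : 'Z_n) :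
  two_colorable a (a - b) -> two_colorable a b.
Proof.
case=> f fP; exists (fun x => f (- x)) => x; have := fP (- x - a).
rewrite subrK addrA subrK -!opprD.
by case: (f _) (f _) (f _) => [] [] [].
Qed.

(** * Three colors *)

(** The integers of the definition are quotients of nonnegative numbers, so they
may be taken to be natural numbers. *)
Lemma three_color_case_nat (n : nat) (a b : 'Z_n) :
  three_color_case a b <->
  exists j A B : nat,
    [/\ (3 ^ j.+1 %| n)%N, (a = 3 ^ j * A :> nat)%N /\ (b = 3 ^ j * B :> nat)%N,
        ~~ (3 %| A)%N /\ ~~ (3 %| B)%N & (3 %| A + B)%N].
Proof.
have natX j : (3 ^+ j = (3 ^ j)%N%:Z)%R by rewrite -natrX natz.
split=> [[j [ma [mb [n3 [Da Db] [a3 b3] ab3]]]]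
        | [j [A [B [n3 [Da Db] [a3 b3] ab3]]]]].
  have nonneg (c : nat) (m : int) : c%:Z = 3 ^+ j * m -> (0 <= m)%R.
    rewrite natX => Dc; have p_gt0 : (0 < 3 ^ j)%N by rewrite expn_gt0.
    by nia.
  have [ma0 mb0] := (nonneg _ _ Da, nonneg _ _ Db).
  exists j, `|ma|%N, `|mb|%N; split=> //; last by lia.
  by rewrite natX in Da Db; nia.
exists j, A%:Z, B%:Z; split=> //; rewrite natX; lia.
Qed.

Lemma ltn_Zp {n : nat} (x : 'Z_n) : (1 < n)%N -> (x < n)%N.
Proof. by case: n x => [|[|n]]. Qed.

Lemma val_ZpD {n : nat} (x y : 'Z_n) :
  (1 < n)%N -> (x + y)%R = ((x + y) %% n)%N :> nat.
Proof. by case: n x y => [|[|n]]. Qed.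

(** Since 3^(j+1) divides n, reduction modulo n changes floor (x / 3^j) by a
multiple of 3. *)
Lemma three_colorable (n : nat) (a b : 'Z_n) :
  (1 < n)%N -> three_color_case a b ->
  polychromatic_colorable [set 0; a; b] 3.
Proof.
move=> n1 /three_color_case_nat[j [A [B [n3 [Da Db] [a3 b3] ab3]]]].
pose f (x : 'Z_n) : 'I_3 := inord ((x %/ 3 ^ j) %% 3).
have val_f x : f x = ((x %/ 3 ^ j) %% 3)%N :> nat by rewrite inordK ?ltn_mod.
have fD (x y : 'Z_n) Y :
    (y = 3 ^ j * Y :> nat)%N -> f (x + y) = ((f x + Y) %% 3)%N :> nat.
  move=> Dy; rewrite !val_f val_ZpD // Dy modnDml.
  have [q Dn] := dvdnP n3; have p_gt0 : (0 < 3 ^ j)%N by rewrite expn_gt0.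
  rewrite [in RHS]addnC -divnMDl // [(Y * _)%N]mulnC [(_ * Y + x)%N]addnC.
  rewrite [in RHS](divn_eq (x + 3 ^ j * Y) n) [X in (_ * X + _)%N]Dn.
  by rewrite expnS !mulnA divnMDl // modnMDl.
apply/polychromatic_tripleP; exists f => x c.
rewrite !inE -!val_eqE /= (fD x a A) // (fD x b B) //.
have := ltn_ord c; have := ltn_ord (f x); lia.
Qed.

(** Periods are closed under integer combinations, so this is the identity of
Bezout. *)
Lemma period_gcd {n : nat} {T : Type} (f : 'Z_n -> T) (x y : nat) :
    (forall z, f (z + x%:R) = f z) -> (forall z, f (z + y%:R) = f z) ->
  forall z, f (z + (gcdn x y)%:R) = f z.
Proof.
move=> fx fy z; case: (posnP x) => [-> | x_gt0]; first by rewrite gcd0n.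
have per t k w : (forall z, f (z + t%:R) = f z) -> f (w + (k * t)%:R) = f w.
  move=> ft; elim: k => [|k IHk]; first by rewrite addr0.
  by rewrite mulSn addnC natrD addrA ft.
have [kx ky Dgcd _] := egcdnP y x_gt0.
by rewrite -(per y ky) // -addrA -natrD addnC -Dgcd per.
Qed.

(** With three colors on three points, all colors of a translate differ, so a
color that avoids two of them is the third. This makes a + b and 3a periods. *)
Lemma three_colorable_case (n : nat) (a b : 'Z_n) :
    (1 < n)%N -> a != 0 -> polychromatic_colorable [set 0; a; b] 3 ->
  three_color_case a b.
Proof.
move=> n1 a0 /polychromatic_tripleP[f fP].
have D x : [/\ f (x + a) != f x, f (x + b) != f x & f (x + a) != f (x + b)].
  have := fP x 0; have := fP x 1; have := fP x (inord 2).
  rewrite !inE -!val_eqE /= inordK //.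
  move: (ltn_ord (f x)) (ltn_ord (f (x + a))) (ltn_ord (f (x + b))).
  by move=> *; split; lia.
have third (t u v w : 'I_3) :
    [/\ v != u, w != u & v != w] -> t != v -> t != w -> t = u.
  case=> vu wu vw tv tw; apply/val_inj => /=; move: vu wu vw tv tw.
  rewrite -!val_eqE /=.
  by move: (ltn_ord t) (ltn_ord u) (ltn_ord v) (ltn_ord w); lia.
have perD x : f (x + a + b) = f x.
  apply: third (D x) _ _; first by have [] := D (x + a).
  by rewrite addrAC; have [] := D (x + b).
have f2 x : f (x + a + a) = f (x + b).
  have [Dxa Dxb Dab] := D x; have := D (x + a); rewrite perD => -[D1 _ D2].
  by apply: (third _ _ (f x) (f (x + a))) => //; split; rewrite // eq_sym.
have per3 x : f (x + a + a + a) = f x.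
  by rewrite f2 perD.
pose g := gcdn (gcdn (a * 3) (a + b)) n.
have fg x : f (x + g%:R) = f x.
  apply: period_gcd => z; last by rewrite pchar_Zp ?addr0.
  apply: period_gcd => y; last by rewrite natrD !natr_Zp addrA perD.
  by rewrite mulnC natrM natr_Zp mulr_natl !mulrS mulr0n addr0 !addrA per3.
(* Otherwise a would be a period, contrary to f (0 + a) != f 0. *)
have gNa : ~~ (g %| a)%N.
  apply/negP=> /dvdnP[c Da]; have [/eqP[]] := D 0.
  rewrite -[a]natr_Zp Da; elim: c {Da} => [|c IHc]; first by rewrite addr0.
  by rewrite mulSn addnC natrD addrA fg.
have [c Dc] : exists c, (a * 3 = c * g)%N.
  by apply/dvdnP; rewrite /g -gcdnA dvdn_gcdl.
(* If 3 divided c = 3a / g, then a = (c / 3) g would be a multiple of g. *)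
have c3 : ~~ (3 %| c)%N.
  apply: contra gNa => /dvdnP[e De]; apply/dvdnP; exists e.
  by apply/eqP; rewrite -(eqn_pmul2r (isT : 0 < 3)%N) Dc De mulnAC.
have a_gt0 : (0 < a)%N by rewrite lt0n.
have [A /[dup] A3 _ Da] := pfactor_coprime (isT : prime 3) a_gt0.
set j := logn 3 a in Da.
have g3 : (3 ^ j.+1 %| g)%N.
  rewrite -(@Gauss_dvdr _ c); last by rewrite coprimeXl // prime_coprime.
  by rewrite -Dc Da expnSr -mulnA dvdn_mull.
have ab3 : (3 ^ j.+1 %| a + b)%N.
  by apply: dvdn_trans g3 _; rewrite /g gcdnAC dvdn_gcdr.
have n3 : (3 ^ j.+1 %| n)%N by apply: dvdn_trans g3 _; rewrite dvdn_gcdr.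
have [B Db] : exists B, (b = B * 3 ^ j :> nat)%N.
  apply/dvdnP; rewrite -(@dvdn_addr a) ?Da ?dvdn_mull // -Da.
  by rewrite (dvdn_trans _ ab3) // expnS dvdn_mull.
have AB3 : (3 %| A + B)%N.
  by move: ab3; rewrite Da Db -mulnDl expnS dvdn_pmul2r ?expn_gt0.
rewrite prime_coprime // in A3.
by apply/three_color_case_nat; exists j, A, B; split=> //; split=> //; lia.
Qed.

(** * Two colors from a half circle *)

(** The hypotheses say that the three arcs into which 0, u and v cut a circle of
length n have length at most n/2. Every half-open half circle then contains a
point of each rotated copy of {0, u, v}. *)
Lemma two_colorable_spread {n : nat} (k : nat) (a b : 'Z_n) :
    let u := nat_of_ord (a *+ k) in let v := nat_of_ord (b *+ k) in
    (1 < n)%N -> (2 * minn u v <= n <= 2 * maxn u v)%N ->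
    (2 * maxn u v <= n + 2 * minn u v)%N ->
  two_colorable a b.
Proof.
move=> u v n1 uv1 uv2; have ltn (x : 'Z_n) : (x < n)%N by exact: ltn_Zp.
have addmod x y : (x < n)%N -> (y < n)%N ->
    ((x + y) %% n = if x + y < n then x + y else x + y - n)%N.
  move=> ltx lty; case: ltnP => [/modn_small // | lenxy].
  by rewrite -{1}(subnK lenxy) modnDr modn_small //; lia.
exists (fun x => 2 * (x *+ k : 'Z_n) < n)%N => x.
rewrite !mulrnDl !val_ZpD // !addmod // -/u -/v.
have [ltun ltvn] : (u < n)%N /\ (v < n)%N by split; apply: ltn.
move: (nat_of_ord (x *+ k)) (ltn (x *+ k)) => w ltwn.
clearbody u v; clear ltn addmod x.
by case: (ltnP (w + u)%N n); case: (ltnP (w + v)%N n); lia.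
Qed.

(** The points of the subgroup d Z_n, of order m, form a circle of length m. *)
Lemma two_colorable_spread_dvd {n : nat} (m d k u v : nat) (a b : 'Z_n) :
    (1 < n)%N -> (n = m * d)%N -> (u < m)%N -> (v < m)%N ->
    a *+ k = (u * d)%:R -> b *+ k = (v * d)%:R ->
    (2 * minn u v <= m <= 2 * maxn u v)%N ->
    (2 * maxn u v <= m + 2 * minn u v)%N ->
  two_colorable a b.
Proof.
move=> n1 Dn ltum ltvm Du Dv uv1 uv2.
have d_gt0 : (0 < d)%N by nia.
have vald w : (w < m)%N -> ((w * d)%:R : 'Z_n) = (w * d)%N :> nat.
  by move=> ltwm; rewrite val_Zp_nat // modn_small // Dn ltn_pmul2r.
apply: (two_colorable_spread k) => //; rewrite Du Dv !vald // Dn; nia.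
Qed.

(** * Orders in the group of residues *)

Lemma order_dvd_mulrn {n : nat} (a : 'Z_n) (i : nat) :
  (#[a]%g %| i)%N = (a *+ i == 0).
Proof. by rewrite order_dvdn FinRing.zmodXgE. Qed.

Lemma order_dvd_modulus {n : nat} (a : 'Z_n) : (1 < n)%N -> (#[a]%g %| n)%N.
Proof. by move=> n1; rewrite order_dvd_mulrn -mulr_natr pchar_Zp ?mulr0. Qed.

(** The order of a is n / gcd (a, n), and gcd (a, n) is a multiple of a modulo n
by the identity of Bezout. *)
Lemma exists_mulrn_index {n : nat} (a : 'Z_n) :
  (1 < n)%N -> exists k, a *+ k = (n %/ #[a]%g)%:R.
Proof.
move=> n1; have [-> | a0] := eqVneq a 0.
  by exists 0%N; rewrite mulr0n order1 divn1 pchar_Zp.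
have a_gt0 : (0 < a)%N by rewrite lt0n.
have [k l Dk _] := egcdnP n a_gt0; set d := gcdn a n in Dk.
have d_gt0 : (0 < d)%N by rewrite gcdn_gt0 a_gt0.
have [a' Da'] : exists a', (a = a' * d :> nat)%N by apply/dvdnP/dvdn_gcdl.
have [m Dn] : exists m, (n = m * d)%N by apply/dvdnP/dvdn_gcdr.
have co_ma : coprime m a'.
  rewrite /coprime -(eqn_pmul2r d_gt0) muln_gcdl -Dn -Da' gcdnC mul1n.
  exact: eqxx.
have dvd_order i : (#[a]%g %| i)%N = (m %| i)%N.
  rewrite order_dvd_mulrn -[a in LHS]natr_Zp -mulrnA -val_eqE /=.
  rewrite val_Zp_nat // -/(dvdn n _) Da' mulnAC Dn.
  by rewrite dvdn_pmul2r // mulnC Gauss_dvdl.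
have -> : #[a]%g = m.
  by apply/eqP; rewrite eqn_dvd dvd_order dvdnn -dvd_order dvdnn.
have -> : (n %/ m = d)%N by rewrite {1}Dn mulKn //; nia.
exists k; rewrite -[a in LHS]natr_Zp -mulrnA mulnC Dk natrD natrM pchar_Zp //.
by rewrite mulr0 add0r.
Qed.

(** A cyclic group has a single subgroup of each order, so annihilation by the
order of a forces membership in the subgroup generated by a. *)
Lemma mulrn_of_order_mulrn0 {n : nat} (a b : 'Z_n) :
    (1 < n)%N -> b *+ #[a]%g = 0 ->
  exists2 q, (q < #[a]%g)%N & b = a *+ q.
Proof.
move=> n1; set m := #[a]%g => bm0; have [k Dk] := exists_mulrn_index a n1.
set d := (n %/ _)%N in Dk.
have Dn : (n = m * d)%N by rewrite mulnC divnK // order_dvd_modulus.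
have m_gt0 : (0 < m)%N := order_gt0 a.
have am0 : a *+ m = 0 by apply/eqP; rewrite -order_dvd_mulrn.
have /dvdnP[c Db] : (d %| b)%N.
  rewrite -(dvdn_pmul2l m_gt0) -Dn mulnC; apply/eqP.
  by rewrite -(val_Zp_nat n1) natrM natr_Zp mulr_natr bm0.
exists ((k * c) %% m)%N; first exact: ltn_pmod.
rewrite -[b]natr_Zp Db mulnC natrM mulr_natr -Dk -mulrnA.
by rewrite [in LHS](divn_eq (k * c) m) mulrnDr mulnC mulrnA am0 mul0rn add0r.
Qed.

(** * Choice of the multiplier *)

(** The multiple of a of order 2 is n/2, so it splits the circle into two
arcs of length n/2, and a third point can only cut one of them. *)
Lemma two_colorable_even (n : nat) (a b : 'Z_n) :
  (1 < n)%N -> ~~ odd #[a]%g -> two_colorable a b.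
Proof.
move=> n1 even_a; set m := #[a]%g in even_a.
have m_gt0 : (0 < m)%N := order_gt0 a.
pose k := m./2; have Dm : (m = k + k)%N by rewrite addnn even_halfK.
have k0 : a *+ k != 0.
  by rewrite -order_dvd_mulrn gtnNdvd -/m; lia.
have kk0 : a *+ k + a *+ k = 0.
  by apply/eqP; rewrite -mulrnDr -Dm -order_dvd_mulrn.
have ltn (x : 'Z_n) : (x < n)%N by exact: ltn_Zp.
have Dk : (2 * (a *+ k : 'Z_n) = n)%N.
  have /(congr1 val) := kk0; rewrite [val _]val_ZpD //=.
  move: k0 (ltn (a *+ k)); rewrite -val_eqE /=.
  move: (nat_of_ord (a *+ k)) => w w0 ltwn.
  move=> /eqP; rewrite -/(dvdn n _) => /dvdnP[[|[|c]] Dc]; nia.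
apply: (two_colorable_spread k) => //; have := ltn (b *+ k); lia.
Qed.

(** An interval of length e contains a point of each residue class modulo e;
here the interval starts at n/2 rounded up. Adding n to v keeps the difference
with c nonnegative. *)
Lemma arc_meets_coset (n e c : nat) :
    (0 < e)%N -> (e %| n)%N -> (3 * e <= n)%N -> (c < n)%N ->
  exists v i, [/\ (v + n = c + e * i)%N, (n <= 2 * v)%N
                 & (2 * v < n + 2 * e)%N].
Proof.
move=> e_gt0 /dvdnP[r Dn] le3e ltcn; pose H := uphalf n.
exists (H + (c + H * e.-1) %% e)%N.
pose j := ((c + H * e.-1) %/ e)%N.
have Dj : (H + (c + H * e.-1) %% e + j * e = c + H * e)%N.
  rewrite -addnA [(_ %% _ + _)%N]addnC -divn_eq.
  by case: (e) e_gt0 => // e' _; rewrite /= mulnS addnCA.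
have := ltn_pmod (c + H * e.-1) e_gt0; move: (_ %% e)%N Dj => w Dj ltwe.
have lejH : (j <= r + H)%N.
  by rewrite -(leq_pmul2r e_gt0) mulnDl -Dn; lia.
exists (r + H - j)%N; split; [|lia..].
rewrite mulnBr mulnDr [(e * r)%N]mulnC -Dn [(e * H)%N]mulnC.
by rewrite [(e * j)%N]mulnC; lia.
Qed.

(** Write m and r for the odd orders of a and of w = mb, both at least 3. The
multipliers k h + m l i all send a to (n/m)(m - 1)/2, which is at least n/3
and at most n/2, and they send b through a coset of step n/r <= n/3. So b can be
sent to the arc of points opposite to those between 0 and the image of a. *)
Lemma two_colorable_outside (n : nat) (a b : 'Z_n) :
    (1 < n)%N -> a != 0 -> odd #[a]%g -> odd #[b]%g -> b *+ #[a]%g != 0 ->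
  two_colorable a b.
Proof.
move=> n1 a0 odd_a odd_b; set m := #[a]%g in odd_a *; set w := b *+ m => w0.
set r := #[w]%g.
have odd_r : odd r.
  apply: dvdn_odd odd_b; rewrite order_dvd_mulrn mulrnAC.
  have /eqP-> : b *+ #[b]%g == 0 by rewrite -order_dvd_mulrn.
  by rewrite mul0rn.
have gt2 (x : 'Z_n) : x != 0 -> odd #[x]%g -> (2 < #[x]%g)%N.
  move=> x0; have : #[x]%g != 1%N by rewrite -dvdn1 order_dvd_mulrn.
  by case: #[x]%g => [|[|[]]].
have [m3 r3] : (2 < m)%N /\ (2 < r)%N by split; apply: gt2.
have [k Dk] := exists_mulrn_index a n1; have [l Dl] := exists_mulrn_index w n1.
set d := (n %/ _)%N in Dk; set e := (n %/ _)%N in Dl.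
have Dn : (n = m * d)%N by rewrite mulnC divnK // order_dvd_modulus.
have Dn' : (n = r * e)%N by rewrite mulnC divnK // order_dvd_modulus.
pose h := m./2; have Dm : (m = 1 + 2 * h)%N by lia.
pose c := nat_of_ord (b *+ (k * h)).
have ltcn : (c < n)%N by exact: ltn_Zp.
have e_gt0 : (0 < e)%N.
  by rewrite lt0n; apply/eqP=> e0; rewrite e0 muln0 in Dn'; lia.
have le3e : (3 * e <= n)%N by rewrite Dn' leq_mul2r r3 orbT.
have le3d : (3 * d <= n)%N by rewrite Dn leq_mul2r m3 orbT.
have Dd : (n = d + 2 * (d * h))%N by rewrite Dn Dm; lia.
have edvdn : (e %| n)%N by rewrite Dn' dvdn_mull.
have [v [i [Di nv vn]]] := arc_meets_coset n e c e_gt0 edvdn le3e ltcn.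
have ltvn : (v < n)%N by move: vn le3e; clear -n1; lia.
have am0 : a *+ m = 0 by apply/eqP; rewrite -order_dvd_mulrn.
have Du : nat_of_ord (a *+ (k * h + m * (l * i))) = (d * h)%N.
  rewrite mulrnDr !mulrnA am0 !mul0rn addr0 Dk -mulrnA val_Zp_nat //.
  by rewrite modn_small //; move: Dd n1; clear; lia.
have Dv : nat_of_ord (b *+ (k * h + m * (l * i))) = v.
  rewrite mulrnDr [b *+ (m * _)]mulrnA -/w [w *+ _]mulrnA.
  rewrite -[X in X + _]natr_Zp -/c Dl -mulrnA.
  by rewrite -natrD -Di natrD pchar_Zp // addr0 val_Zp_nat // modn_small.
apply: (two_colorable_spread (k * h + m * (l * i))) => //; rewrite Du Dv;
  by move: (d * h)%N Dd nv vn le3e le3d; clear; lia.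
Qed.

(** The subgroup generated by a is a circle of length m on which a is the unit
step, up to a multiplier; so only k and v = k q mod m matter. *)
Lemma two_colorable_multiple {n : nat} (a : 'Z_n) (q k s v : nat) :
    let m := #[a]%g in (1 < n)%N -> (k < m)%N -> (v < m)%N ->
    (k * q = s * m + v)%N ->
    (2 * minn k v <= m <= 2 * maxn k v)%N ->
    (2 * maxn k v <= m + 2 * minn k v)%N ->
  two_colorable a (a *+ q).
Proof.
move=> m n1 ltkm ltvm Dkq kv1 kv2; have [l Dl] := exists_mulrn_index a n1.
set d := (n %/ _)%N in Dl.
have Dn : (n = m * d)%N by rewrite mulnC divnK // order_dvd_modulus.
apply: (two_colorable_spread_dvd m d (l * k) k v) => //.
  by rewrite mulrnA Dl -mulrnA mulnC.
rewrite -mulrnA mulnCA mulrnA Dl -mulrnA [(q * k)%N]mulnC Dkq mulnDr natrD.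
by rewrite mulnCA [(d * m)%N]mulnC -Dn natrM pchar_Zp // mulr0 add0r mulnC.
Qed.

(** For m = 2h + 1 and q = 2(p + 1), the multiplier h sends q to -(p + 1), and
0, h and m - (p + 1) are spread out. *)
Lemma two_colorable_even_multiple {n : nat} (a : 'Z_n) (q : nat) :
    (1 < n)%N -> odd #[a]%g -> (0 < q < #[a]%g)%N -> ~~ odd q ->
  two_colorable a (a *+ q).
Proof.
move=> n1; set m := #[a]%g => odd_m q_bounds even_q.
have [p Dq] : exists p, q = (2 * p.+1)%N by exists q./2.-1; lia.
have [h Dm] : exists h, m = (2 * h + 1)%N by exists m./2; lia.
by apply: (two_colorable_multiple a q h p (m - p.+1)); rewrite -/m //; lia.
Qed.

(** N is the largest odd number with N q <= 2 m. *)
Lemma odd_multiplier_window (m q : nat) :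
    odd m -> odd q -> (2 < q)%N -> (2 * q <= m + 1)%N ->
    ~ (m = 7 /\ q = 3)%N ->
  exists N, [/\ odd N, (m <= N * (q - 1))%N & (N * q <= 2 * m)%N].
Proof.
move=> odd_m odd_q q3 leqm not_fano.
have [t [letm ltmt]] : exists t, (t * q <= 2 * m)%N /\ (2 * m < t.+1 * q)%N.
  by exists (2 * m %/ q)%N; rewrite leq_trunc_div ltn_ceil //; lia.
have t3 : (2 < t)%N.
  rewrite -ltnS -(ltn_pmul2r (ltnW (ltnW q3))).
  by apply: leq_ltn_trans ltmt; lia.
have {q3} [p Dq] : exists p, q = p.+3 by exists (q - 3)%N; lia.
have {t3} [s Dt] : exists s, t = s.+3 by exists (t - 3)%N; lia.
(* After these shifts the inequalities hold coefficient by coefficient. *)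
subst q t; have [odd_t | even_t] := boolP (odd s.+3).
  by exists s.+3; split=> //; lia.
exists s.+2; split; try lia.
have [s1 | s3] : s = 1%N \/ (2 < s)%N by lia.
  (* Here t = 4, and 2m < 5q with q >= 5 is enough; q = 3 would give m = 7. *)
  by subst s; lia.
have {s3} [u Ds] : exists u, s = u.+3 by exists (s - 3)%N; lia.
by subst s; lia.
Qed.

(** For k = (m + N)/2 with N odd, k q is congruent to (N q - m)/2 modulo m. The
gaps between 0, (N q - m)/2 and (m + N)/2 are (N q - m)/2, m - N(q - 1)/2 and
(m - N)/2, and the inequalities on N say that they are at most m/2. *)
Lemma two_colorable_odd_multiple {n : nat} (a : 'Z_n) (q : nat) :
    (1 < n)%N -> odd #[a]%g -> odd q -> (2 < q)%N -> (2 * q <= #[a]%g + 1)%N ->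
    ~ (#[a]%g = 7 /\ q = 3)%N ->
  two_colorable a (a *+ q).
Proof.
move=> n1; set m := #[a]%g => odd_m odd_q q3 leqm not_fano.
have [N [odd_N leN ltN]] :=
  odd_multiplier_window m q odd_m odd_q q3 leqm not_fano.
have DN1 : (N * (q - 1) + N = N * q)%N by rewrite -mulnSr subn1 prednK //; lia.
have le3Nq : (N * 3 <= N * q)%N by rewrite leq_mul2l q3 orbT.
have [k Dk] : exists k, (2 * k = m + N)%N by exists (m + N)./2; lia.
have [v Dv] : exists v, (2 * v + m = N * q)%N.
  by exists (N * q - m)./2; have := oddM N q; rewrite odd_N odd_q; lia.
have [s Ds] : exists s, (2 * s = q + 1)%N by exists (q + 1)./2; lia.
by apply: (two_colorable_multiple a q k s v); rewrite -/m //; lia.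
Qed.

(** * The exceptional case and the theorem *)

(** The triples {i, i + 1, i + q} modulo 7 are the lines of a Fano plane; all
colorings of its seven points are inspected. *)
Lemma fano_not_two_colorable {n : nat} (a : 'Z_n) (q : nat) :
  #[a]%g = 7%N -> q = 3%N \/ q = 5%N -> ~ two_colorable a (a *+ q).
Proof.
move=> a7 q35 [f fP]; pose g i := f (a *+ (i %% 7)).
have {}fP i : ~~ ((g i.+1 == g i) && (g (i + q)%N == g i)).
  have gE j : g j = f (a *+ j).
    have a70 : a *+ 7 = 0 by apply/eqP; rewrite -order_dvd_mulrn a7.
    rewrite /g [in RHS](divn_eq j 7) mulrnDr mulnC mulrnA a70.
    by rewrite mul0rn add0r.
  by have := fP (a *+ i); rewrite -mulrSr -mulrnDr -!gE.
move: (fP 0%N) (fP 1%N) (fP 2%N) (fP 3%N) (fP 4%N) (fP 5%N) (fP 6%N).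
have g7 i : g (7 + i)%N = g i by rewrite /g modnDl.
case: q35 => ->; rewrite /= ?(g7 0, g7 1, g7 2, g7 3, g7 4)%N.
  by case: (g 0%N) (g 1%N) (g 2%N) (g 3%N) (g 4%N) (g 5%N) (g 6%N)
    => [] [] [] [] [] [] [].
by case: (g 0%N) (g 1%N) (g 2%N) (g 3%N) (g 4%N) (g 5%N) (g 6%N)
  => [] [] [] [] [] [] [].
Qed.

Lemma two_colorable_odd_order (n : nat) (a b : 'Z_n) :
    (1 < n)%N -> a != 0 -> b != 0 -> a != b -> odd #[a]%g -> odd #[b]%g ->
    ~ one_color_case a b ->
  two_colorable a b.
Proof.
move=> n1 a0 b0 ab odd_a odd_b not_fano; set m := #[a]%g in odd_a.
have [/(mulrn_of_order_mulrn0 _ _ n1)[q ltqm Db] | bm0] := eqVneq (b *+ m) 0;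
  last exact: two_colorable_outside.
rewrite -/m in ltqm.
have q0 : q <> 0%N by move=> q0; rewrite Db q0 eqxx in b0.
have q1 : q <> 1%N by move=> q1; rewrite Db q1 eqxx in ab.
have q35 : m = 7%N -> q <> 3%N /\ q <> 5%N.
  move=> m7; have n7 : (7 %| n)%N by rewrite -m7 order_dvd_modulus.
  by split=> Dq; apply: not_fano; split=> //; rewrite Db Dq; [left | right].
have [odd_q | even_q] := boolP (odd q); rewrite Db; last first.
  by apply: two_colorable_even_multiple; rewrite // -/m; lia.
have [leqm | ltmq] := leqP (2 * q)%N (m + 1).
  by apply: two_colorable_odd_multiple; rewrite // -/m; lia.
(* The reflection replaces q by m + 1 - q, which is also odd. *)
apply: two_colorable_reflect.
have -> : a - a *+ q = a *+ (m + 1 - q).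
  have am0 : a *+ m = 0 by apply/eqP; rewrite -order_dvd_mulrn.
  by rewrite mulrnBr ?mulrnDr ?am0 ?add0r //; lia.
by apply: two_colorable_odd_multiple; rewrite // -/m; lia.
Qed.

Theorem theorem2p7 (n : nat) (a b : 'Z_n) :
  (3 <= n)%N -> a != 0 -> b != 0 -> a != b ->
  [/\ three_color_case a b -> polychromatic_number [set 0; a; b] = 3%N,
      one_color_case a b -> polychromatic_number [set 0; a; b] = 1%N
    & ~ three_color_case a b -> ~ one_color_case a b ->
      polychromatic_number [set 0; a; b] = 2%N].
Proof.
move=> /ltnW n1 a0 b0 ab; split=> [three | [_ a7 Db] | not_three not_one].
- apply: polychromatic_number_eq => //; first exact: three_colorable.
  apply/negP=> /polychromatic_colorable_leq; apply/negP; rewrite -ltnNge ltnS.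
  by rewrite -setUA cardsU1 cards2; case: (0 \notin _); case: (a != b).
- apply: polychromatic_number_eq => //.
    by apply/polychromatic_colorable1/set0Pn; exists 0; rewrite !inE eqxx.
  apply/negP=> /two_colorableP; case: Db => ->.
    by apply: fano_not_two_colorable => //; left.
  by apply: fano_not_two_colorable => //; right.
apply: polychromatic_number_eq => //.
  apply/two_colorableP; have [odd_a | even_a] := boolP (odd #[a]%g).
    have [odd_b | even_b] := boolP (odd #[b]%g).
      exact: two_colorable_odd_order.
    by apply: two_colorable_sym; apply: two_colorable_even.
  exact: two_colorable_even.
by apply/negP=> /(three_colorable_case _ _ _ n1 a0).
Qed.
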